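(* Let $n\geq 1$ be an integer, let $D_n$ be the $n$-th diamond poset, let $k$ be a field, $S_n=k[y_1,\ldots,y_{4n}]$ and $T_n=k[x_1,\ldots,x_{3n+1}]$, with $I_{\mathrm{LD}}(D_n)\subseteq S_n$ and $I_{2n+1}(D_n)\subseteq T_n$. Then: (i) $\operatorname{height}(I_{\mathrm{LD}}(D_n))=2$ and $\operatorname{height}(I_{2n+1}(D_n))=1$; (ii) $\dim(S_n/I_{\mathrm{LD}}(D_n))=4n-2$ and $\dim(T_n/I_{2n+1}(D_n))=3n$.
   Context: For posets $P,Q$ on disjoint ground sets, $P\oplus Q$ is the poset on the union in which $x<y$ iff $x<_P y$, or $x<_Q y$, or $x\in P$ and $y\in Q$. $D_1$ is the poset on $\{x_1,x_2,x_3,x_4\}$ with cover relations $x_1<x_2$, $x_1<x_3$, $x_2<x_4$, $x_3<x_4$. For $n\geq 2$, $D_n=\widetilde D_{n-1}\oplus D_1$, where $\widetilde D_{n-1}$ is $D_{n-1}$ with its maximum element removed. Thus $D_n$ consists of $n$ diamonds piled on top of each other; it has $3n+1$ elements, identified with $x_1,\ldots,x_{3n+1}$, and $4n$ cover relations (edges of the Hasse diagram), identified with $y_1,\ldots,y_{4n}$. $I_{\mathrm{LD}}(D_n)\subseteq S_n$ is the ideal generated by the monomials $\prod_{e\in\pi}y_e$, where $\pi$ runs over the maximal saturated chains of $D_n$ and the product is over the cover relations (edges) of $\pi$. $I_{2n+1}(D_n)\subseteq T_n$ is the path ideal generated by the monomials $\prod_{v\in\pi}x_v$, where $\pi$ runs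 over the saturated chains with $2n+1$ elements (these are the maximal chains) and the product is over the elements of $\pi$. $\dim$ is Krull dimension. *)

(* Defs.v *)
From HB Require Import structures.
From mathcomp Require Import all_boot all_order all_algebra.
From mathcomp Require Import ring_quotient boolp mpoly.

Set Implicit Arguments.
Unset Strict Implicit.
Unset Printing Implicit Defensive.

Import Order.TTheory GRing.Theory.

Local Open Scope order_scope.

Fact poset_display : Order.disp_t. Proof. exact: Order.Disp tt tt. Qed.

Local Notation poset := (finPOrderType poset_display).

Definition covers (P : poset) (x y : P) : bool :=
  (x < y) && ~~ [exists z, x < z < y].

Definition is_max (P : poset) (x : P) : bool := [forall y, y <= x].

Definition rm_max_type (P : poset) : Type := {x : P | ~~ is_max x}.

HB.instance Definition _ (P : poset) := Finite.on (rm_max_type P).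
HB.instance Definition _ (P : poset) := SubType.on (rm_max_type P).
HB.instance Definition _ (P : poset) :=
  [SubChoice_isSubPOrder of rm_max_type P by <: with poset_display].

Definition rm_max (P : poset) : poset := rm_max_type P.

Definition osum_type (P Q : poset) : Type := (P + Q)%type.

HB.instance Definition _ (P Q : poset) := Finite.on (osum_type P Q).

Section OrdinalSum.
Variables P Q : poset.

Definition osum_lt (u v : osum_type P Q) : bool :=
  match u, v with
  | inl x, inl y => x < y
  | inr x, inr y => x < y
  | inl _, inr _ => true
  | inr _, inl _ => false
  end.

Fact osum_lt_irr : irreflexive osum_lt.
Proof. by case=> x /=; rewrite ltxx. Qed.

Fact osum_lt_trans : transitive osum_lt.
Proof. by move=> [y|y] [x|x] [z|z] //=; apply: lt_trans. Qed.

HB.instance Definition _ :=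
  Order.Lt_isPOrder.Build poset_display (osum_type P Q)
    osum_lt_irr osum_lt_trans.

Definition osum : poset := osum_type P Q.

End OrdinalSum.

(* The element x_i is the ordinal i - 1. *)
Definition D1_type : Type := 'I_4.

HB.instance Definition _ := Finite.on D1_type.

Definition D1_cover : rel D1_type := fun x y =>
  (nat_of_ord x, nat_of_ord y)
    \in [:: (0%N, 1%N); (0%N, 2%N); (1%N, 3%N); (2%N, 3%N)].

Definition D1_le : rel D1_type := connect D1_cover.

Fact D1_leE x y : D1_le x y =
  [|| x == y, nat_of_ord x == 0%N | nat_of_ord y == 3%N].
Proof.
apply/idP/idP.
  case/connectP=> p; elim: p x => [|z p IHp] x /=.
    by move=> _ ->; rewrite eqxx.
  case/andP=> xz zp /(IHp _ zp); move: xz; rewrite /D1_cover !inE !xpair_eqE.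
  move=> Hxz /or3P[/eqP zy | /eqP z0 | ->]; last by rewrite !orbT.
    by rewrite -zy; case/or4P: Hxz => /andP[/eqP-> /eqP->]; rewrite ?orbT.
  by rewrite z0 /= !andbF in Hxz.
have eq_le a b : nat_of_ord a = nat_of_ord b -> D1_le a b.
  by move=> /val_inj ->; apply: connect0.
have le03 a b : nat_of_ord a = 0%N -> nat_of_ord b = 3%N -> D1_le a b.
  move=> a0 b3; have H1 : (1 < 4)%N by [].
  by apply: (@connect_trans _ _ (Ordinal H1)); apply: connect1;
    rewrite /D1_cover ?a0 ?b3.
case: x y => [[|[|[|[|//]]]] Hx] [[|[|[|[|//]]]] Hy];
  rewrite -?val_eqE //= => _;
  by [exact: eq_le | exact: le03 | apply: connect1].
Qed.

Fact D1_le_refl : reflexive D1_le.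
Proof. by move=> x; apply: connect0. Qed.

Fact D1_le_anti : antisymmetric D1_le.
Proof.
move=> x y; rewrite !D1_leE => H; apply/val_inj; move: H; rewrite -!val_eqE /=.
by case: x y => [[|[|[|[|//]]]] Hx] [[|[|[|[|//]]]] Hy].
Qed.

Fact D1_le_trans : transitive D1_le.
Proof. by move=> y x z; apply: connect_trans. Qed.

HB.instance Definition _ :=
  Order.Le_isPOrder.Build poset_display D1_type
    D1_le_refl D1_le_anti D1_le_trans.

Definition D1 : poset := D1_type.

Definition point_type : Type := unit.
HB.instance Definition _ := Finite.on point_type.
Fact point_le_anti : antisymmetric (fun _ _ : point_type => true).
Proof. by case; case. Qed.
HB.instance Definition _ :=
  Order.Le_isPOrder.Build poset_display point_type
    (fun=> isT) point_le_anti (fun _ _ _ _ _ => isT).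

(* At n = 0, the one-point poset is a convention, so that the counts 3n+1 and
   4n of elements and edges hold for all n. *)
Fixpoint diamond (n : nat) : poset :=
  match n with
  | 0 => point_type
  | 1 => D1
  | n'.+1 => osum (rm_max (diamond n')) D1
  end.

Definition edge (P : poset) : finType := {e : P * P | covers e.1 e.2}.

Lemma osumE (P Q : poset) (u v : osum P Q) : (u < v) = osum_lt u v.
Proof. by []. Qed.

Lemma covers_osum (P Q : poset) (u v : osum P Q) : covers u v =
  match u, v with
  | inl x, inl y => covers x y
  | inr x, inr y => covers x y
  | inl x, inr y => ~~ [exists z, x < z] && ~~ [exists z, z < y]
  | inr _, inl _ => false
  end.
Proof.
case: u v => x [] y //=; rewrite /covers osumE //=.
- congr (_ && ~~ _); apply/existsP/existsP => -[z Hz]; last by exists (inl z).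
  by case: z Hz => z; rewrite !osumE //= ?andbF //; exists z.
- rewrite -negb_or; congr (~~ _); apply/existsP/orP.
    by case=> -[] z; rewrite !osumE /= ?andbT => Hz; [left|right];
      apply/existsP; exists z.
  by case=> /existsP[z Hz]; [exists (inl z)|exists (inr z)];
    rewrite !osumE /= ?Hz.
- congr (_ && ~~ _); apply/existsP/existsP => -[z Hz]; last by exists (inr z).
  by case: z Hz => z; rewrite !osumE //=; exists z.
Qed.

Lemma rm_max_ltE (P : poset) (x y : rm_max P) : (x < y) = (val x < val y).
Proof. by rewrite !lt_def. Qed.

Lemma lt_not_max (P : poset) (x y : P) : x < y -> ~~ is_max x.
Proof. by move=> xy; apply/negP => /forallP/(_ y); rewrite lt_geF. Qed.

Lemma covers_rm_max (P : poset) (x y : rm_max P) :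
  covers x y = covers (val x) (val y).
Proof.
rewrite /covers rm_max_ltE; congr (_ && ~~ _).
apply/existsP/existsP => -[z /andP[xz zy]].
  by exists (val z); rewrite -!rm_max_ltE xz.
by exists (Sub z (lt_not_max zy)); rewrite !rm_max_ltE SubK xz.
Qed.

Lemma card_edge (P : poset) :
  #|edge P| = (\sum_(x : P) \sum_(y : P) covers x y)%N.
Proof.
rewrite card_sig -sum1_card big_mkcond /= pair_big /=.
by apply: eq_bigr => -[x y] _; rewrite inE /=; case: covers.
Qed.

Lemma is_maxE (P : poset) (t x : P) : is_max t -> is_max x = (x == t).
Proof.
move=> tM; apply/idP/eqP => [/forallP xM|->] //.
by apply/le_anti; rewrite xM (forallP tM).
Qed.

Lemma big_rm_max (P : poset) (t : P) (F : P -> nat) : is_max t ->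
  (\sum_(x : P) F x = F t + \sum_(x : rm_max P) F (val x))%N.
Proof.
move=> tM; rewrite (bigD1 t) //=; congr addn.
rewrite (eq_bigl (fun x => ~~ is_max x)); last by move=> x; rewrite (is_maxE _ tM).
exact: (big_sub [pred x : P | ~~ is_max x]).
Qed.

Lemma card_rm_max (P : poset) (t : P) : is_max t -> #|P| = #|rm_max P|.+1.
Proof.
by move=> tM; rewrite -!sum1_card (big_rm_max (fun=> 1%N) tM).
Qed.

Lemma covers_max (P : poset) (t : P) (x : rm_max P) : is_max t ->
  covers (val x) t = ~~ [exists z, x < z].
Proof.
move=> tM; have ltt (z : P) : (z < t) = ~~ is_max z.
  by rewrite (is_maxE _ tM) lt_neqAle (forallP tM) andbT.
rewrite /covers ltt (valP x) /=; congr (~~ _).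
apply/existsP/existsP => -[z]; last first.
  by rewrite rm_max_ltE => xz; exists (val z); rewrite xz ltt (valP z).
case/andP=> xz zt; rewrite ltt in zt.
by exists (Sub z zt); rewrite rm_max_ltE SubK.
Qed.

Lemma edge_rm_max (P : poset) (t : P) : is_max t ->
  #|edge P|
    = (#|edge (rm_max P)| + \sum_(x : rm_max P) ~~ [exists z, x < z]%O)%N.
Proof.
move=> tM; rewrite !card_edge (big_rm_max _ tM) big1 ?add0n; last first.
  move=> y _; rewrite /covers; case ty: (t < y) => //=.
  by have := lt_geF ty; rewrite (forallP tM).
rewrite -big_split /=; apply: eq_bigr => x _.
rewrite (big_rm_max _ tM) covers_max // addnC; congr addn.
by apply: eq_bigr => y _; rewrite covers_rm_max.
Qed.

Lemma D1_ltE (x y : D1) : (x < y) =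
  (x != y) && ((nat_of_ord x == 0%N) || (nat_of_ord y == 3%N)).
Proof. by rewrite lt_neqAle [x <= y]D1_leE; case: eqP. Qed.

Lemma D1_max : is_max (ord_max : D1).
Proof. by apply/forallP => y; rewrite [_ <= _]D1_leE !orbT. Qed.

Lemma D1_minE (y : D1) : ~~ [exists z, z < y] = (nat_of_ord y == 0%N).
Proof.
apply/idP/idP.
  apply: contraNT => y0; apply/existsP; exists (ord0 : D1).
  by rewrite D1_ltE /= andbT; apply: contra y0 => /eqP <-.
move=> y0; apply/existsPn => z; rewrite D1_ltE -val_eqE /= (eqP y0) orbF.
by case: eqP.
Qed.

Lemma D1_coversE (x y : D1) : covers x y = D1_cover x y.
Proof.
have H1 : (1 < 4)%N by [].
have ex03 (a b : D1) : nat_of_ord a = 0%N -> nat_of_ord b = 3%N ->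
    [exists z, a < z < b].
  move=> a0 b3; apply/existsP; exists (Ordinal H1 : D1).
  by rewrite !D1_ltE -!val_eqE /= a0 b3.
rewrite /covers D1_ltE; case: x y => [[|[|[|[|//]]]] Hx] [[|[|[|[|//]]]] Hy];
  rewrite -?val_eqE //=; rewrite /D1_cover /=;
  try (by apply/existsPn => -[[|[|[|[|//]]]] Hz]; rewrite !D1_ltE -!val_eqE).
by rewrite ex03.
Qed.

Lemma card_edge_D1 : #|edge D1| = 4.
Proof.
rewrite card_edge; under eq_bigr => x _ do under eq_bigr => y _ do rewrite D1_coversE.
by rewrite !big_ord_recl !big_ord0.
Qed.

Lemma osum_max (P Q : poset) (t : Q) :
  is_max t -> is_max (inr t : osum P Q).
Proof.
move=> tM; apply/forallP => -[] y; rewrite le_eqVlt osumE //= ?orbT //.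
by have := forallP tM y; rewrite le_eqVlt => /orP[/eqP->|->]; rewrite ?eqxx ?orbT.
Qed.

Lemma diamond_max n : exists t, is_max (t : diamond n).
Proof.
case: n => [|[|n]]; first by exists tt; apply/forallP; case.
  by exists ord_max; apply: D1_max.
by exists (inr ord_max); apply/osum_max/D1_max.
Qed.

Lemma card_diamond n : #|diamond n| = (3 * n).+1.
Proof.
elim: n => [|[|n] IHn]; rewrite ?card_unit ?card_ord //.
have [t tM] := diamond_max n.+1.
change (#|{: rm_max (diamond n.+1) + D1}| = (3 * n.+2).+1).
rewrite card_sum card_ord; move: IHn; rewrite (card_rm_max tM) => -[->].
by rewrite [in RHS]mulnS addnC.
Qed.

Lemma card_edge_osum (P Q : poset) : #|edge (osum P Q)| =
  (#|edge P| + #|edge Q| + (\sum_(x : P) ~~ [exists z, x < z]%O)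
                           * (\sum_(y : Q) ~~ [exists z, z < y]%O))%N.
Proof.
rewrite !card_edge big_sumType /= addnAC; congr addn; last first.
  apply: eq_bigr => x _; rewrite big_sumType big1 ?add0n => [|y _].
    by apply: eq_bigr => y _; rewrite covers_osum.
  by rewrite covers_osum.
rewrite big_distrl -big_split /=; apply: eq_bigr => x _.
rewrite big_sumType big_distrr /=.
congr addn; apply: eq_bigr => y _; rewrite covers_osum //.
by rewrite mulnb.
Qed.

Lemma card_edge_diamond n : #|edge (diamond n)| = (4 * n)%N.
Proof.
elim: n => [|[|n] IHn].
- by rewrite card_edge !big1 // => -[] _; rewrite big1 // => -[].
- exact: card_edge_D1.
have [t tM] := diamond_max n.+1.
rewrite [LHS]card_edge_osum card_edge_D1 [in RHS]mulnS -IHn (edge_rm_max tM).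
under [X in (_ * X)%N]eq_bigr => y _ do rewrite D1_minE.
by rewrite !big_ord_recl big_ord0 /= muln1 addnAC addnC addnA.
Qed.

(* The numbering of vertices and of edges is the enumeration order of the
   finite types; another numbering only permutes the variables. *)
Definition vertex_label n : diamond n -> 'I_(3 * n).+1 :=
  fun v => cast_ord (card_diamond n) (enum_rank v).

Definition edge_label n : edge (diamond n) -> 'I_(4 * n) :=
  fun e => cast_ord (card_edge_diamond n) (enum_rank e).

Definition saturated_chain (P : poset) (s : seq P) : bool := sorted (@covers P) s.

(* Saturated chains are strictly increasing, so inclusion is [subseq]. *)
Definition maximal_saturated_chain (P : poset) (s : seq P) : Prop :=
  saturated_chain s /\
  forall s' : seq P, saturated_chain s' -> subseq s s' -> s' = s.

Local Open Scope ring_scope.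

Definition ideal_gen (R : comNzRingType) (G : R -> Prop) : {pred R} :=
  fun f => `[< exists2 s : seq (R * R),
    (forall u, u \in s -> G u.2) & f = \sum_(u <- s) u.1 * u.2 >].

(* [zip s (behead s)] lists the edges of the chain s, as consecutive pairs. *)
Definition LD_generator (k : fieldType) (P : poset) m (lab : edge P -> 'I_m)
    (f : {mpoly k[m]}) : Prop :=
  exists2 s : seq P, maximal_saturated_chain s &
    f = \prod_(e : edge P | val e \in zip s (behead s)) 'X_(lab e).

Definition path_generator (k : fieldType) (P : poset) m (lab : P -> 'I_m)
    (t : nat) (f : {mpoly k[m]}) : Prop :=
  exists2 s : seq P, saturated_chain s && (size s == t) &
    f = \prod_(v <- s) 'X_(lab v).

Definition I_LD (k : fieldType) (n : nat) : {pred {mpoly k[4 * n]}} :=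
  ideal_gen (LD_generator (@edge_label n)).

Definition I_path (k : fieldType) (n : nat) : {pred {mpoly k[(3 * n).+1]}} :=
  ideal_gen (path_generator (@vertex_label n) (2 * n).+1).

Arguments I_LD : clear implicits.
Arguments I_path : clear implicits.

Lemma ideal_gen_closed (R S : comNzRingType) (phi : {rmorphism R -> S})
    (G : R -> Prop) :
  (forall f, G f -> phi f = 0) -> idealr_closed (ideal_gen G).
Proof.
move=> G0; split.
- by apply/asboolP; exists [::] => //; rewrite big_nil.
- apply/asboolP => -[s sG /(congr1 phi)/eqP].
  rewrite rmorph1 rmorph_sum big_seq big1 ?oner_eq0 // => u /sG/G0 u0.
  by rewrite rmorphM u0 mulr0.
move=> a f g /asboolP[s sG ->] /asboolP[s' sG' ->]; apply/asboolP.
exists ([seq (a * u.1, u.2) | u <- s] ++ s').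
  by move=> u; rewrite mem_cat => /orP[/mapP[v vs ->]|]; [exact: (sG v)|exact: sG'].
rewrite big_cat big_map /= mulr_sumr; congr (_ + _).
by apply: eq_bigr => u _; rewrite mulrA.
Qed.

Lemma lt_covers (P : poset) (x y : P) : (x < y)%O ->
  (exists z, covers x z) /\ (exists z, covers z y).
Proof.
move=> xy; split.
  case: (@arg_minnP _ y (fun z => x < z)%O (fun z => #|[pred w | w < z]%O|) xy)
    => z xz zmin.
  exists z; rewrite /covers xz; apply/existsPn => w; apply/andP => -[xw wz].
  have := zmin _ xw; apply/negP; rewrite -ltnNge; apply/proper_card/properP.
  split; first by apply/subsetP => v; rewrite !inE => /lt_trans; apply.
  by exists w; rewrite !inE ?ltxx.
case: (@arg_minnP _ x (fun z => z < y)%O (fun z => #|[pred w | z < w]%O|) xy)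
  => z zy zmin.
exists z; rewrite /covers zy; apply/existsPn => w; apply/andP => -[zw wy].
have := zmin _ wy; apply/negP; rewrite -ltnNge; apply/proper_card/properP.
split; first by apply/subsetP => v; rewrite !inE; apply: lt_trans.
by exists w; rewrite !inE ?ltxx.
Qed.

Lemma maximal_chain_edge n (s : seq (diamond n)) : (0 < n)%N ->
  maximal_saturated_chain s -> exists e : edge (diamond n),
    val e \in zip s (behead s).
Proof.
move=> n_gt0 [].
have [t tM] := diamond_max n.
case: s => [_ /(_ [:: t] isT isT)//|x [|y s]]; last first.
  by case/andP=> xy _ _; exists (Sub (x, y) xy); rewrite SubK inE eqxx.
move=> _ smax; have no_up z : ~~ covers x z.
  apply/negP => xz; have := smax [:: x; z]; rewrite /saturated_chain /= xz eqxx.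
  by move=> /(_ isT isT).
have no_down z : ~~ covers z x.
  apply/negP => zx; have := smax [:: z; x]; rewrite /saturated_chain sub1seq.
  by rewrite !inE eqxx orbT /= zx => /(_ isT isT).
have [xt|xt] := eqVneq x t; last first.
  have /lt_covers[[z]] : (x < t)%O by rewrite lt_neqAle xt (forallP tM).
  by rewrite (negPf (no_up z)).
have : (0 < #|predC1 t|)%N by rewrite cardC1 card_diamond; case: (n) n_gt0.
case/card_gt0P => y; rewrite inE => yt.
have /lt_covers[_ [z]] : (y < x)%O by rewrite xt lt_neqAle yt (forallP tM).
by rewrite (negPf (no_down z)).
Qed.

Lemma I_LD_closed (k : fieldType) n : (0 < n)%N -> idealr_closed (I_LD k n).
Proof.
move=> n_gt0; apply: (@ideal_gen_closed _ _ (meval (fun=> 0))).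
move=> _ [s /(maximal_chain_edge n_gt0)[e es] ->].
by rewrite rmorph_prod (bigD1 e) //= mevalXU mul0r.
Qed.

Lemma I_path_closed (k : fieldType) n : idealr_closed (I_path k n).
Proof.
apply: (@ideal_gen_closed _ _ (meval (fun=> 0))).
move=> _ [[|v s] // _ ->].
by rewrite rmorph_prod big_cons /= mevalXU mul0r.
Qed.

(* Bundled as proper ideals, so that {ideal_quot _} is the quotient ring. *)
Definition I_LD_idealr (k : fieldType) n (n_gt0 : (0 < n)%N) :
    idealr {mpoly k[4 * n]} :=
  HB.pack (I_LD k n : {mpoly k[4 * n]} -> bool)
    (isIdealr.Build _ _ (I_LD_closed k n_gt0)).

Definition I_path_idealr (k : fieldType) n : idealr {mpoly k[(3 * n).+1]} :=
  HB.pack (I_path k n : {mpoly k[(3 * n).+1]} -> bool)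
    (isIdealr.Build _ _ (I_path_closed k n)).

Section Dimension.
Variable R : comNzRingType.
Implicit Types (p q P I : {pred R}) (c : nat -> {pred R}).

(* Prime ideals are proper: [idealr_closed] requires [1 \notin p]. *)
Definition prime_ideal p : Prop := idealr_closed p /\ prime_idealr_closed p.

Definition strict_sub p q : Prop := {subset p <= q} /\ ~ {subset q <= p}.

(* c 0 < c 1 < ... < c d ; the values of c beyond d are irrelevant. *)
Definition prime_chain c (d : nat) : Prop :=
  (forall i, (i <= d)%N -> prime_ideal (c i)) /\
  (forall i, (i < d)%N -> strict_sub (c i) (c i.+1)).

Definition krull_dim (d : nat) : Prop :=
  (exists c, prime_chain c d) /\
  (forall c e, prime_chain c e -> (e <= d)%N).

Definition prime_height P (h : nat) : Prop :=
  (exists2 c, prime_chain c h & c h =i P) /\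
  (forall c e, prime_chain c e -> c e =i P -> (e <= h)%N).

(* Primes of infinite height have no [prime_height]; they cannot lower the
   minimum. *)
Definition height I (h : nat) : Prop :=
  (exists P, [/\ prime_ideal P, {subset I <= P} & prime_height P h]) /\
  (forall P e, prime_ideal P -> {subset I <= P} -> prime_height P e ->
     (h <= e)%N).

End Dimension.

Arguments krull_dim R d : clear implicits.

(* Main.v *)
Require Import Defs.
From mathcomp Require Import all_boot all_order all_algebra.
From mathcomp Require Import ring_quotient boolp mpoly.

(* Every chain of primes in a polynomial ring in m variables over a field has
   length at most m: along a chain p_0 < ... < p_r, elements x_i of p_(i+1) that
   are not in p_i are algebraically independent, and m + 1 polynomials in m
   variables never are, by a count of monomials.

   Hence an ideal I contained in an ideal generated by h variables, and such that
   every prime above I contains h variables, has height h and a quotient of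
   dimension m - h. For I_path h = 1: all maximal chains pass through the
   top element. For I_LD h = 2: all maximal chains end with one of the two top
   edges, and two edge-disjoint maximal chains each contribute a
   variable to a prime above the ideal. *)

Set Implicit Arguments.
Unset Strict Implicit.
Unset Printing Implicit Defensive.

Import Order.TTheory.

(** * Saturated chains of the diamond posets *)

Lemma mem_zip_behead (T : eqType) (s : seq T) x y :
  (x, y) \in zip s (behead s) -> (x \in s) && (y \in s).
Proof.
elim: s => //= z [|w s] IHs //; rewrite [zip _ _]/= !inE xpair_eqE.
case/orP=> [/andP[/eqP-> /eqP->]|/IHs]; first by rewrite !eqxx orbT.
by rewrite !inE => /andP[-> ->]; rewrite !orbT.
Qed.

Lemma zip_behead_rcons2 (T : eqType) (s : seq T) x y :
  (x, y) \in zip (rcons (rcons s x) y) (behead (rcons (rcons s x) y)).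
Proof.
elim: s => [|z s IHs]; first by rewrite /= inE.
rewrite rcons_cons rcons_cons /= ; case: s IHs => [|w s] IHs.
  by rewrite /= !inE eqxx orbT.
by rewrite /= inE; apply/orP; right.
Qed.

Section SaturatedChains.
Variable P : finPOrderType poset_display.
Implicit Types (x y t : P) (s : seq P) (r : P -> nat).

Lemma covers_lt x y : covers x y -> (x < y)%O.
Proof. by case/andP. Qed.

Lemma saturated_chain_rank r s x :
  (forall x y, covers x y -> r y = (r x).+1) -> path (@covers P) x s ->
  r (last x s) = (r x + size s)%N.
Proof.
move=> rS; elim: s x => [|y s IHs] x /=; first by rewrite addn0.
by case/andP=> /rS ry /IHs ->; rewrite ry addnS.
Qed.

Lemma saturated_chain_max r d s : (forall x y, covers x y -> r y = (r x).+1) ->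
    (forall x, r x <= d)%N -> saturated_chain s ->
  (size s <= d.+1)%N.
Proof.
move=> rS rd; case: s => //= x s /(saturated_chain_rank rS) xs.
by rewrite ltnS (leq_trans _ (rd (last x s))) // xs leq_addl.
Qed.

(** A rank function bounded by [d] leaves room for at most [d.+1] elements in a saturated chain, so
    one of that size cannot be extended. *)
Lemma maximal_of_size r d s : (forall x y, covers x y -> r y = (r x).+1) ->
    (forall x, r x <= d)%N -> saturated_chain s -> size s = d.+1 ->
  maximal_saturated_chain s.
Proof.
move=> rS rd sP sd; split=> // s' s'P ss'; apply/esym/eqP.
rewrite -(size_subseq_leqif ss') eqn_leq size_subseq // sd.
exact: saturated_chain_max rS rd s'P.
Qed.

Lemma saturated_chain_last r d s t : (forall x y, covers x y -> r y = (r x).+1) ->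
    (forall x, r x <= d)%N -> (forall x, r x = d -> x = t) ->
    saturated_chain s -> size s = d.+1 ->
  exists s', s = rcons s' t.
Proof.
move=> rS rd rt; case: s => //= x s /(saturated_chain_rank rS) xs [sd].
exists (belast x s); rewrite lastI (rt (last x s)) //.
by apply/eqP; rewrite eqn_leq rd xs sd leq_addl.
Qed.

(** A chain ending below [t] could be extended upwards by a cover, and the chain [[:: t]] downwards
    by [a]. *)
Lemma maximal_chain_last s t a : is_max t -> covers a t ->
  maximal_saturated_chain s -> exists s' x, s = rcons (rcons s' x) t /\ covers x t.
Proof.
move=> tM at_; case/lastP: s => [|s x] [sP smax].
  by have := smax [:: t] isT isT.
have xt : x = t.
  apply/eqP; apply: contraT => xt.
  have [[z xz] _] : (exists z, covers x z) /\ (exists z, covers z t).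
    by apply: lt_covers; rewrite lt_neqAle xt (forallP tM).
  have := smax (rcons (rcons s x) z); rewrite subseq_rcons /saturated_chain => H.
  have sz : sorted (@covers P) (rcons (rcons s x) z).
    by rewrite -[rcons _ z]cats1 cat_rcons sorted_cat_cons /= xz !andbT; apply: sP.
  by have /(congr1 size) /eqP := H sz isT; rewrite !size_rcons eqn_leq ltnn.
rewrite xt in sP smax *.
case/lastP: s sP smax => [|s y] sP smax.
  have := smax [:: a; t]; rewrite (sub1seq t) /saturated_chain /= at_ !inE eqxx orbT.
  by move=> /(_ isT isT).
exists s, y; split=> //.
move: sP; rewrite /saturated_chain -[rcons _ t]cats1 cat_rcons sorted_cat_cons.
by rewrite /= !andbT => /andP[].
Qed.

End SaturatedChains.

Definition D1_rank (y : D1) : nat :=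
  if nat_of_ord y == 0%N then 0 else if nat_of_ord y == 3%N then 2 else 1.

Lemma D1_rank_covers (x y : D1) : covers x y -> D1_rank y = (D1_rank x).+1.
Proof.
rewrite D1_coversE /D1_cover /D1_rank.
by case: x y => [[|[|[|[|//]]]] ?] [[|[|[|[|//]]]] ?].
Qed.

Lemma D1_rank_le (y : D1) : (D1_rank y <= 2)%N.
Proof. by case: y => [[|[|[|[|//]]]] ?]. Qed.

Lemma D1_rank_max (y : D1) : (D1_rank y == 2%N) = is_max y.
Proof.
transitivity (nat_of_ord y == 3%N); last by rewrite (is_maxE y D1_max).
by case: y => [[|[|[|[|//]]]] ?].
Qed.

(** The bottom of each added diamond takes the place of the removed maximum and inherits its
    rank. *)
Lemma diamond_rank n : exists r : diamond n -> nat,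
  [/\ forall x y, covers x y -> r y = (r x).+1,
      forall x, (r x <= 2 * n)%N & forall x, (r x == 2 * n)%N = is_max x].
Proof.
elim: n => [|[|n] IHn].
- exists (fun=> 0%N); split=> // x.
  by rewrite eqxx; apply/esym/forallP => y; case: x y => [] [].
- by exists D1_rank; split; [exact: D1_rank_covers|exact: D1_rank_le|exact: D1_rank_max].
have [r [rS rle rmax]] := IHn.
have [t tM] := diamond_max n.+1.
change (exists r : osum (rm_max (diamond n.+1)) D1 -> nat,
  [/\ forall x y, covers x y -> r y = (r x).+1,
      forall x, (r x <= 2 * n.+2)%N & forall x, (r x == 2 * n.+2)%N = is_max x]).
exists (fun u => match u with inl x => r (val x) | inr y => 2 * n.+1 + D1_rank y end)%N.
split=> [[x|x] [y|y]|[x|x]|[x|x]]; rewrite ?covers_osum //.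
- by rewrite covers_rm_max => /rS.
(* At the joint, [x] is covered by the removed maximum [t], whose rank is [2 * n.+1], and [y] is the
   bottom of [D1]. *)
- rewrite -(covers_max x tM) D1_minE => /andP[/rS rt y0].
  by rewrite -rt /D1_rank y0 addn0; apply/esym/eqP; rewrite rmax.
- by move=> /D1_rank_covers ->; rewrite addnS.
- by rewrite (leq_trans (rle _)) // leq_mul2l leqnSn orbT.
- by rewrite [(2 * n.+2)%N]mulnSr leq_add2l D1_rank_le.
- have lt : (r (val x) < 2 * n.+2)%N.
    by apply: leq_ltn_trans (rle _) _; rewrite ltn_mul2l ltnSn.
  by rewrite (is_maxE _ (osum_max _ D1_max)) ltn_eqF.
- rewrite [(2 * n.+2)%N]mulnSr eqn_add2l D1_rank_max (is_maxE _ (osum_max _ D1_max)).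
  by rewrite (is_maxE _ D1_max).
Qed.

Lemma diamond_top n : exists t a b : diamond n.+1,
  [/\ is_max t, a != b, covers a t, covers b t & forall x, covers x t -> x \in [:: a; b]].
Proof.
pose a := Ordinal (isT : 1 < 4)%N : D1; pose b := Ordinal (isT : 2 < 4)%N : D1.
pose t := ord_max : D1.
have top1 : [/\ is_max t, a != b, covers a t, covers b t &
    forall x, covers x t -> x \in [:: a; b]].
  split; rewrite ?D1_coversE //; first exact: D1_max.
  move=> x; rewrite D1_coversE /D1_cover !inE -!val_eqE /=.
  by case: x => [[|[|[|[|//]]]] ?].
have [tM ab at_ bt xt] := top1.
case: n => [|n]; first by exists t, a, b.
change (exists t a b : osum (rm_max (diamond n.+1)) D1,
  [/\ is_max t, a != b, covers a t, covers b t & forall x, covers x t -> x \in [:: a; b]]).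
exists (inr t), (inr a), (inr b); split; rewrite ?covers_osum //; first exact: osum_max.
case=> x; rewrite covers_osum; first by rewrite D1_minE andbF.
by move=> /xt; rewrite !inE.
Qed.

Lemma rm_max_lift (P : finPOrderType poset_display) (s : seq P) :
  all (predC (@is_max P)) s -> exists s' : seq (rm_max P), s = map val s'.
Proof.
elim: s => [|x s IHs]; first by exists [::].
by case/andP=> xM /IHs[s' ->]; exists (Sub x xM :: s').
Qed.

(* The two chains only meet in the joints between consecutive diamonds, and no
   joint covers another. *)
Lemma diamond_two_chains n : exists s s' : seq (diamond n.+1),
  [/\ saturated_chain s && (size s == (2 * n.+1).+1),
      saturated_chain s' && (size s' == (2 * n.+1).+1) &
      forall x y, covers x y -> x \in s -> x \in s' -> y \in s -> y \notin s'].
Proof.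
pose a := Ordinal (isT : 1 < 4)%N : D1; pose b := Ordinal (isT : 2 < 4)%N : D1.
pose o := ord0 : D1; pose t1 := ord_max : D1.
elim: n => [|n [s [s' [/andP[sP /eqP sz] /andP[sP' /eqP sz'] disj]]]].
  exists [:: o; a; t1], [:: o; b; t1]; split; rewrite ?/saturated_chain /= ?D1_coversE //.
  move=> x y; rewrite D1_coversE /D1_cover !inE -!val_eqE /=.
  by case: x y => [[|[|[|[|//]]]] ?] [[|[|[|[|//]]]] ?].
have [t tM] := diamond_max n.+1.
have [r [rS rle rmax]] := diamond_rank n.+1.
(* Drop [t] from the end of a chain of full size and climb the new diamond through [c] instead. *)
have lift (q : seq (diamond n.+1)) : saturated_chain q -> size q = (2 * n.+1).+1 ->
    exists q' : seq (rm_max (diamond n.+1)), q = rcons (map val q') t /\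
      forall c, covers o c -> covers c t1 ->
       saturated_chain (map inl q' ++ map inr [:: o; c; t1] :
         seq (osum (rm_max (diamond n.+1)) D1)).
  move=> qP qz; have rt x : r x = (2 * n.+1)%N -> x = t.
    by move=> /eqP; rewrite rmax (is_maxE _ tM) => /eqP.
  have [q1 q1E] := saturated_chain_last rS rle rt qP qz; subst q.
  have q1M : all (predC (@is_max _)) q1.
    have : pairwise (fun x y : diamond n.+1 => (x < y)%O) (rcons q1 t).
      rewrite -sorted_pairwise; last exact: lt_trans.
      by apply: sub_sorted qP => x y; apply: covers_lt.
    by rewrite pairwise_rcons => /andP[+ _]; apply: sub_all => x; apply: lt_not_max.
  have [q' q'E] := rm_max_lift q1M; subst q1; exists q'; split=> // c oc ct.
  (* The size leaves elements before [t]; the last of them is covered by [t], hence maximal once [t]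
     is removed, and so covered by [o] in the ordinal sum. *)
  case: q' qP qz {q1M} => [|x q'] qP qz; first by [].
  move: qP; rewrite /saturated_chain /= rcons_path path_map last_map.
  rewrite (covers_max _ tM) cat_path path_map last_map => /andP[qP lq].
  apply/andP; split.
    by apply: sub_path qP => u v; rewrite /= covers_osum covers_rm_max.
  by rewrite /= !covers_osum oc ct lq D1_minE.
have [q [qE qL]] := lift _ sP sz; have [q' [qE' qL']] := lift _ sP' sz'.
change (exists s s' : seq (osum (rm_max (diamond n.+1)) D1),
  [/\ saturated_chain s && (size s == (2 * n.+2).+1),
      saturated_chain s' && (size s' == (2 * n.+2).+1) &
      forall x y, covers x y -> x \in s -> x \in s' -> y \in s -> y \notin s']).
exists (map inl q ++ map inr [:: o; a; t1]), (map inl q' ++ map inr [:: o; b; t1]).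
have szq c (p : seq (rm_max (diamond n.+1))) : size (rcons (map val p) t) = (2 * n.+1).+1 ->
    size (map inl p ++ map inr [:: o; c; t1] : seq (osum (rm_max (diamond n.+1)) D1))
      == (2 * n.+2).+1.
  rewrite size_rcons size_cat !size_map => -[->].
  by rewrite [(2 * n.+2)%N]mulnSr -addnS.
split.
- by rewrite qL ?szq -?qE // D1_coversE.
- by rewrite qL' ?szq -?qE' // D1_coversE.
have meml x c (p : seq (rm_max (diamond n.+1))) :
    (inl x \in (map inl p ++ map inr c : seq (osum (rm_max (diamond n.+1)) D1))) = (x \in p).
  rewrite mem_cat mem_map; last by move=> ? ? [].
  by rewrite orbC; case: mapP => [[]|].
have memr x c (p : seq (rm_max (diamond n.+1))) :
    (inr x \in (map inl p ++ map inr c : seq (osum (rm_max (diamond n.+1)) D1))) = (x \in c).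
  by rewrite mem_cat [X in _ || X]mem_map; [case: mapP => [[]|]|move=> ? ? []].
have memq x (p : seq (rm_max (diamond n.+1))) : x \in p -> val x \in rcons (map val p) t.
  by move=> xp; rewrite mem_rcons inE map_f ?orbT.
case=> x [] y; rewrite covers_osum ?meml ?memr //.
- rewrite covers_rm_max => xy xq xq' yq.
  apply/negP => yq'; have := disj _ _ xy; rewrite qE qE' !memq //.
  by move=> /(_ isT isT isT).
(* A shared edge at the joint would make [t] cover a common element [x] of the old chains, and [t]
   lies on both of them. *)
- rewrite -(covers_max _ tM) => /andP[xt _] xq xq' _.
  have := disj _ _ xt; rewrite qE qE' !memq // !mem_rcons !mem_head.
  by move=> /(_ isT isT isT).
- rewrite D1_coversE /D1_cover !inE -!val_eqE /=.
  by case: x y => [[|[|[|[|//]]]] ?] [[|[|[|[|//]]]] ?].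
Qed.

(** * Chains of prime ideals *)

Import GRing.Theory.
Local Open Scope ring_scope.

Section Ideals.
Variables (R : comNzRingType) (p : {pred R}).
Hypothesis pI : idealr_closed p.

Lemma ideal0 : 0 \in p. Proof. by case: pI. Qed.

Lemma ideal1 : 1 \notin p. Proof. by case: pI. Qed.

Lemma idealMD a f g : f \in p -> g \in p -> a * f + g \in p.
Proof. by case: pI => _ _; apply. Qed.

Lemma idealD f g : f \in p -> g \in p -> f + g \in p.
Proof. by rewrite -{2}[f]mul1r; apply: idealMD. Qed.

Lemma idealM a f : f \in p -> a * f \in p.
Proof. by move=> fp; rewrite -[a * f]addr0; apply/idealMD/ideal0. Qed.

Lemma idealB f g : f \in p -> g \in p -> f - g \in p.
Proof. by move=> fp gp; rewrite -mulN1r addrC; apply: idealMD. Qed.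

Lemma ideal_sum (J : Type) (r : seq J) (Q : pred J) (F : J -> R) :
  (forall j, Q j -> F j \in p) -> \sum_(j <- r | Q j) F j \in p.
Proof. by move=> Fp; apply: (big_ind (fun f => f \in p) ideal0 idealD). Qed.

Lemma idealDl f g : f \in p -> (f + g \in p) = (g \in p).
Proof.
move=> fp; apply/idP/idP => [/idealB /(_ fp)|]; last exact: idealD.
by rewrite addrC addKr.
Qed.

Lemma ideal_gen_sub (G : R -> Prop) :
  (forall f, G f -> f \in p) -> {subset ideal_gen G <= p}.
Proof.
move=> Gp f /asboolP[s sG ->]; rewrite big_seq.
by apply: ideal_sum => u /sG /Gp; apply: idealM.
Qed.

End Ideals.

Lemma mem_ideal_gen (R : comNzRingType) (G : R -> Prop) f :
  G f -> f \in ideal_gen G.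
Proof.
move=> Gf; apply/asboolP; exists [:: (1, f)]; last by rewrite big_seq1 mul1r.
by move=> u /[1!inE] /eqP->.
Qed.

Section Primes.
Variables (R : comNzRingType) (p : {pred R}).
Hypothesis pP : prime_ideal p.

Lemma prime_mulP f g : f * g \in p -> (f \in p) \/ (g \in p).
Proof. by case: pP => _ pr /pr /orP. Qed.

Lemma prime_prod (J : Type) (r : seq J) (Q : pred J) (F : J -> R) :
  \prod_(j <- r | Q j) F j \in p -> exists2 j, Q j & F j \in p.
Proof.
elim/big_rec: _ => [p1|j f Qj IH /prime_mulP[Fj|]]; last exact: IH.
  by have := ideal1 pP.1; rewrite p1.
by exists j.
Qed.

Lemma prime_exp f m : f ^+ m \in p -> f \in p.
Proof.
elim: m => [|m IHm]; first by rewrite (negPf (ideal1 pP.1)).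
by rewrite exprS => /prime_mulP[].
Qed.

End Primes.

Section Chains.
Variable R : comNzRingType.
Implicit Types c : nat -> {pred R}.

Lemma prime_chain_sub c d i j : prime_chain c d -> (i <= j <= d)%N ->
  {subset c i <= c j}.
Proof.
move=> [_ cS]; elim: j => [|j IHj]; first by case/andP; rewrite leqn0 => /eqP-> _ f.
rewrite leq_eqVlt ltnS => /andP[/predU1P[-> _ f //|ij] jd f fi].
have [cj _] := cS _ jd.
by apply: cj; apply: IHj => //; rewrite ij ltnW.
Qed.

(** The term [c d] is replaced by [c' 0], so an inclusion suffices at the joint and the lengths add
    up. *)
Lemma prime_chain_cat c c' d e : prime_chain c d -> prime_chain c' e ->
  {subset c d <= c' 0} ->
  prime_chain (fun i => if (i < d)%N then c i else c' (i - d)%N) (d + e).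
Proof.
move=> [cP cS] [c'P c'S] cc'; split => i id.
  by case: ltnP => di; [apply/cP/ltnW | apply: c'P; rewrite leq_subLR].
have [id'|id'] := ltnP i.+1 d.
  by rewrite (ltnW id'); apply/cS/ltnW.
case: ltnP => [di|di].
  have <- : i.+1 = d by apply/eqP; rewrite eqn_leq di.
  rewrite subnn; have [S N] := cS _ di.
  have di' : i.+1 = d by apply/eqP; rewrite eqn_leq di.
  split=> [f /S|H]; first by rewrite di'; apply: cc'.
  by apply: N => f; rewrite di' => /cc' /H.
by rewrite subSn //; apply: c'S; rewrite ltn_subLR.
Qed.

Lemma prime_chain_drop c d h : prime_chain c d -> (h <= d)%N ->
  prime_chain (fun i => c (h + i)%N) (d - h).
Proof.
move=> [cP cS] hd; split=> i id; first by apply: cP; rewrite -leq_subRL.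
by rewrite addnS; apply: cS; rewrite -ltn_subRL.
Qed.

End Chains.

(** * Chains of primes in a polynomial ring over a field *)

Section DimensionBound.
Variable k : fieldType.

(** Exponent vectors of length [r] with entries below [N], as nested pairs so that induction on [r]
    splits off the first variable. *)
Fixpoint expo (N r : nat) : finType :=
  if r is r'.+1 then ('I_N * expo N r')%type else unit.

Lemma card_expo N r : #|{: expo N r}| = (N ^ r)%N.
Proof. by elim: r => [|r IHr]; rewrite ?card_unit // card_prod card_ord IHr expnS. Qed.

Fixpoint monom (R : comNzRingType) N (x : nat -> R) r : expo N r -> R :=
  if r is r'.+1
  then fun e => x 0%N ^+ e.1 * monom (fun i => x i.+1) e.2
  else fun=> 1.

(* Successive division by the lowest power of x_0, x_1, ... occurring: an
   algebraic relation with lexicographically least exponent e would put its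
   coefficient v e in the last prime of the chain. *)
Lemma chain_independent (A : comAlgType k) N r (c : nat -> {pred A})
    (x : nat -> A) (v : expo N r -> k) : prime_chain c r ->
  (forall i, (i < r)%N -> x i \notin c i /\ x i \in c i.+1) ->
  \sum_e v e *: monom x e \in c 0%N -> forall e, v e = 0.
Proof.
elim: r c x v => [|r IHr] c x v cP xc.
  rewrite (bigD1 tt) //= big1 ?addr0 => [v1 [] | []] //.
  have [[pI _] _] := (cP.1 0%N isT, tt).
  apply/eqP; apply: contraNT (ideal1 pI) => v0.
  by rewrite -[1](scalerK v0) -mulr_algl; apply: idealM.
have [x0 x1] := xc 0%N isT.
have P0 := cP.1 0%N isT; have P1 := cP.1 1%N isT.
pose S j : A := \sum_(e : expo N r) v (j, e) *: monom (fun i => x i.+1) e.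
have -> : \sum_e v e *: monom x e = \sum_(j < N) x 0%N ^+ j * S j.
  under [RHS]eq_bigr => j _ do rewrite mulr_sumr.
  by rewrite pair_bigA; apply: eq_bigr => -[j e] _; rewrite /= scalerAr.
move=> Sc [j e] /=.
(* Strong induction on the power [j] of [x 0]: the sums [S i] with [i < j] vanish, and the tail of
   the chain handles [S j] once it lies in [c 1]. *)
have [m] := ubnP j; elim: m => // m IHm in j e *; rewrite ltnS => jm.
apply: (IHr (fun i => c i.+1) (fun i => x i.+1) (fun e => v (j, e))).
- by have := prime_chain_drop cP (isT : 0 < r.+1)%N; rewrite subn1.
- by move=> i ir; apply: xc.
rewrite -/(S j).
move: Sc; rewrite (bigID (fun i : 'I_N => i < j)%N) /= big1 ?add0r; last first.
  move=> i ij; rewrite [S i]big1 ?mulr0 // => f _.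
  by rewrite IHm ?scale0r // (leq_trans ij).
rewrite (bigD1 j) /= ?ltnn //.
have -> : \sum_(i < N | ~~ (i < j)%N && (i != j)) x 0%N ^+ i * S i
   = x 0%N ^+ j * (x 0%N *
      \sum_(i < N | ~~ (i < j)%N && (i != j)) x 0%N ^+ (i - j.+1) * S i).
  rewrite 2!mulr_sumr; apply: eq_bigr => i; rewrite -leqNgt => /andP[ji ij].
  have lt_ji : (j < i)%N by rewrite ltn_neqAle ji eq_sym ij.
  by rewrite !mulrA -exprSr -exprD subnKC.
(* As [x 0] is not in the prime [c 0], the cofactor of [x 0 ^+ j] lies in [c 0], hence in [c 1]; it
   is [S j] plus a multiple of [x 0], which is in [c 1]. *)
rewrite -mulrDr => /(prime_mulP P0)[/(prime_exp P0)|]; first by rewrite (negPf x0).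
have /prime_chain_sub/(_ (isT : 0 <= 1 <= r.+1)%N) c01 := cP.
move=> /c01; rewrite addrC idealDl //; first by case: P1.
by rewrite mulrC; apply: idealM => //; case: P1.
Qed.

(** [msize] is the total degree plus one, or 0 for the zero polynomial; bounds by successors are
    degree bounds in both cases. *)
Lemma leq_msizeM m (f g : {mpoly k[m]}) a b :
  (msize f <= a.+1)%N -> (msize g <= b.+1)%N -> (msize (f * g) <= (a + b).+1)%N.
Proof.
have [->|f0] := eqVneq f 0; first by rewrite mul0r msize0.
have [->|g0] := eqVneq g 0; first by rewrite mulr0 msize0.
by move=> fa gb; rewrite msizeM //; have := leq_add fa gb; rewrite addSn addnS; case: (_ + _)%N.
Qed.

Lemma msize_monom m N d (x : nat -> {mpoly k[m]}) r (e : expo N r) :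
  (forall i, (i < r)%N -> msize (x i) <= d.+1)%N ->
  (msize (monom x e) <= (r * (N * d)).+1)%N.
Proof.
elim: r x e => [|r IHr] x e xd /=; first by rewrite msize1.
rewrite mulSn; apply: leq_msizeM; last by apply: IHr => i ir; apply: xd.
apply: (@leq_trans (e.1 * d).+1); last by rewrite ltnS leq_mul2r (ltnW (ltn_ord _)) orbT.
elim: (nat_of_ord e.1) => [|j IHj]; first by rewrite expr0 msize1.
by rewrite exprS mulSn; apply: leq_msizeM => //; apply: xd.
Qed.

(* More monomials in the x_i than coefficients available to tell their linear
   combinations apart. *)
Lemma algebraic_dependence m (x : nat -> {mpoly k[m]}) :
  exists N, exists v : expo N m.+1 -> k,
    \sum_e v e *: monom x e = 0 /\ exists e, v e != 0.
Proof.
(* Products of the [x i] with exponents below [N] have degree below [K], so [K ^ m] coefficients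
   describe each; [N] is chosen so that [K ^ m <= (C.+1 * N) ^ m < N ^ m.+1], the number of exponent
   vectors. *)
pose d := (\max_(i < m.+1) msize (x i))%N.
pose C := (m.+1 * d).+1; pose N := (C.+1 ^ m).+1; pose K := (N * C)%N.+1.
exists N.
pose M : 'M[k]_(#|{: expo N m.+1}|, #|{: {ffun 'I_m -> 'I_K}}|) :=
  \matrix_(i, j) (monom x (enum_val i))@_
    [multinom nat_of_ord ((enum_val j : {ffun 'I_m -> 'I_K}) l) | l < m].
have notfree : ~~ row_free M.
  apply/negP => /eqP rM; have := rank_leq_col M; rewrite rM card_expo card_ffun !card_ord.
  apply/negP; rewrite -ltnNge.
  apply: (@leq_ltn_trans ((C.+1 * N) ^ m)%N).
    have [->|m_gt0] := posnP m; first by rewrite !expn0.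
    rewrite leq_exp2r // mulSn [(C * N)%N]mulnC.
    by apply: (@leq_add 1 (N * C)).
  by rewrite expnMn expnS ltn_pmul2r ?expn_gt0.
rewrite -kermx_eq0 in notfree.
have [u /sub_kermxP uM /rV0Pn[i ui]] := rowV0Pn notfree.
exists (fun e => u 0 (enum_rank e)); split; last first.
  by exists (enum_val i); rewrite enum_valK.
apply/mpolyP => a; rewrite mcoeff0 raddf_sum /=.
(* Exponents below [K] correspond to columns of [M]; beyond them every coefficient is zero by
   degree. *)
have [/forallP aK|/forallPn[l]] := boolP [forall l, a l < K]%N.
  pose j : 'I__ := enum_rank ([ffun l => Ordinal (aK l)] : {ffun 'I_m -> 'I_K}).
  transitivity ((u *m M) 0 j); last by rewrite uM mxE.
  rewrite mxE (reindex (@enum_val _ {: expo N m.+1})); last first.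
    by exists enum_rank => e _; rewrite ?enum_valK ?enum_rankK.
  apply: eq_bigr => h _; rewrite mcoeffZ enum_valK mxE; congr (_ * _@_ _).
  by apply/mnmP => l; rewrite mnmE enum_rankK ffunE.
rewrite -leqNgt => Kal; apply: big1 => e _; rewrite mcoeffZ.
rewrite [_@_a]memN_msupp_eq0 ?mulr0 // msize_mdeg_ge //.
apply: leq_trans _ (leq_trans Kal _); last first.
  by rewrite mdegE (bigD1 l) //= leq_addr.
apply: (leq_trans (msize_monom (d := d) (x := x) (r := m.+1) e _)).
  move=> h hm; apply: leqW; exact: (leq_bigmax (Ordinal hm)).
by rewrite ltnS mulnCA leq_mul2l leqW ?orbT.
Qed.

Lemma prime_chain_mpoly m (c : nat -> {pred {mpoly k[m]}}) d :
  prime_chain c d -> (d <= m)%N.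
Proof.
move=> cP; rewrite leqNgt; apply/negP => md.
have cP' : prime_chain c m.+1.
  by split=> i im; [apply: cP.1 | apply: cP.2]; apply: leq_trans im md.
have ex i : exists f, (i < m.+1)%N -> f \notin c i /\ f \in c i.+1.
  have [im|_] := ltnP i m.+1; last by exists 0.
  have [_ /existsNP[f /not_implyP[fc /negP nf]]] := cP'.2 i im.
  by exists f.
have [x xc] := choice ex.
have [N [v [v0 [e]]]] := algebraic_dependence x.
rewrite (chain_independent cP' xc) ?eqxx // v0.
by apply: ideal0; case: (cP'.1 0%N isT).
Qed.

End DimensionBound.

(** * Primes of a quotient ring *)

Section QuotientDimension.
Variables (R : comNzRingType) (I : idealr R) (d : nat).
Local Notation Q := {ideal_quot I}.
Local Notation piQ := (\pi_Q)%qT.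

Lemma pi_ideal0 (f : R) : f \in I -> piQ f = 0.
Proof.
by move=> fI; apply/eqP; rewrite -(rmorph0 piQ) -Quotient.idealrBE subr0.
Qed.

Lemma prime_ideal_preim (p : {pred Q}) : prime_ideal p ->
  prime_ideal [pred f | piQ f \in p] /\ {subset I <= [pred f | piQ f \in p]}.
Proof.
move=> [pI pr]; split=> [|f fI]; last by rewrite inE /= pi_ideal0 // ideal0.
split=> [|f g]; last by rewrite !inE /= rmorphM; apply: pr.
split; rewrite ?inE /= ?rmorph0 ?rmorph1 ?ideal0 ?ideal1 //.
by move=> a f g; rewrite !inE /= rmorphD rmorphM; apply: idealMD.
Qed.

(** Membership in the image of [p] is tested on representatives; since [I] lies in [p], the choice
    of representative does not matter. *)
Lemma prime_ideal_quot (p : {pred R}) : prime_ideal p -> {subset I <= p} ->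
  exists2 q : {pred Q}, prime_ideal q & forall f, (piQ f \in q) = (f \in p).
Proof.
move=> [pI pr] Ip; pose q : {pred Q} := [pred u | repr u \in p].
have qE f : (piQ f \in q) = (f \in p).
  have : repr (piQ f) - f \in I by rewrite Quotient.idealrBE reprK.
  by move=> /Ip /(idealDl pI) <-; rewrite subrK.
exists q => //; split.
  split; rewrite -?(rmorph0 piQ) -?(rmorph1 piQ) ?qE ?ideal0 ?ideal1 //.
  move=> a f g; rewrite -[a]reprK -[f]reprK -[g]reprK -rmorphM -rmorphD !qE.
  exact: idealMD.
by move=> f g; rewrite -[f]reprK -[g]reprK -rmorphM !qE; apply: pr.
Qed.

(** Inverse and direct images under the projection carry chains of primes of the quotient to chains
    of primes above [I] and back. *)
Lemma krull_dim_quot :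
  (exists2 c : nat -> {pred R}, prime_chain c d & {subset I <= c 0%N}) ->
  (forall (c : nat -> {pred R}) e,
     prime_chain c e -> {subset I <= c 0%N} -> (e <= d)%N) ->
  krull_dim Q d.
Proof.
move=> [c cP Ic] dmax; split=> [|c' e [c'P c'S]]; last first.
  apply: (dmax (fun i => [pred f | piQ f \in c' i])).
    split=> i ie; first by have [] := prime_ideal_preim (c'P i ie).
    have [sub nsub] := c'S i ie; split=> [f|H]; first exact: sub.
    by apply: nsub => u; rewrite -[u]reprK => /H.
  by have [_] := prime_ideal_preim (c'P 0%N isT).
have ex i : exists q : {pred Q}, (i <= d)%N ->
    prime_ideal q /\ forall f, (piQ f \in q) = (f \in c i).
  have [id|_] := leqP i d; last by exists (fun=> false).
  have Ici : {subset I <= c i}.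
    by move=> f /Ic; apply: prime_chain_sub cP _ _; rewrite id.
  by have [q] := prime_ideal_quot (cP.1 i id) Ici; exists q.
have [q qP] := choice ex.
exists q; split=> i id; first by case: (qP i id).
have [_ qi] := qP i (ltnW id); have [_ qi1] := qP i.+1 id.
have [sub nsub] := cP.2 i id; split=> [u|H].
  by rewrite -[u]reprK qi qi1; apply: sub.
by apply: nsub => f; rewrite -qi -qi1; apply: H.
Qed.

End QuotientDimension.

(** * Ideals generated by variables, and codimension *)

Section VariableIdeals.
Variables (k : fieldType) (m : nat).
Local Notation S := {mpoly k[m]}.
Implicit Types (s : seq 'I_m) (p : {pred S}).

Definition kill_vars s : m.-tuple S := [tuple if i \in s then 0 else 'X_i | i < m].

(* The ideal generated by the X_i with i in s, as the kernel of the
   substitution X_i := 0. *)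
Definition var_ideal s : {pred S} := [pred f : S | f \mPo kill_vars s == 0].

Lemma var_ideal_prime s : prime_ideal (var_ideal s).
Proof.
split=> [|f g]; last by rewrite !inE rmorphM mulf_eq0.
split; rewrite ?inE ?rmorph0 ?rmorph1 ?oner_eq0 // => a f g.
by rewrite !inE => /eqP fs /eqP gs; rewrite rmorphD rmorphM /= fs gs mulr0 addr0.
Qed.

Lemma mem_var_ideal s i : ('X_i \in var_ideal s) = (i \in s).
Proof.
rewrite inE comp_mpolyXU -tnth_nth tnth_mktuple.
by case: (i \in s); rewrite ?eqxx // -msupp_eq0 msuppX.
Qed.

(** Subtracting from [f] its image under [X_i := 0], which is zero, cancels the monomials free of
    variables of [s]; every other monomial is a multiple of some [X_i] with [i] in [s]. *)
Lemma var_ideal_sub s p : idealr_closed p ->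
  (forall i, i \in s -> 'X_i \in p) -> {subset var_ideal s <= p}.
Proof.
move=> pI sp f; rewrite inE => /eqP f0; rewrite -[f]subr0 -f0.
rewrite comp_mpolyEX {1}[f]mpolyE -sumrB; apply: ideal_sum => // a _.
rewrite -scalerBr -mul_mpolyC; apply: idealM => //.
rewrite comp_mpolyX {1}mpolyXE_id.
have [/existsP[i /andP[si ai]]|/existsPn none] := boolP [exists i, (i \in s) && (a i != 0%N)].
  rewrite [X in _ - X](bigD1 i) //= tnth_mktuple si expr0n (negPf ai) mul0r subr0.
  rewrite (bigD1 i) //= mulrC; apply: idealM => //; case: (a i) ai => // j _.
  by rewrite exprSr; apply/idealM/sp.
rewrite [X in X - _](eq_bigr (fun i => tnth (kill_vars s) i ^+ a i)) ?subrr ?ideal0 //.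
move=> i _; rewrite tnth_mktuple; have := none i.
by case: (i \in s) => //=; rewrite negbK => /eqP->; rewrite !expr0.
Qed.

Lemma var_chain (s : seq 'I_m) : uniq s ->
  prime_chain (fun j => var_ideal (take j s)) (size s).
Proof.
move=> us; split=> j js; first exact: var_ideal_prime.
have [i0 _] : exists i : 'I_m, True by case: s js {us} => // i; exists i.
rewrite (take_nth i0) //; split=> [|H].
  apply: var_ideal_sub; first by case: (var_ideal_prime (rcons (take j s) (nth i0 s j))).
  by move=> i si; rewrite mem_var_ideal mem_rcons inE si orbT.
(* The variable added at step [j] separates the two ideals, since [uniq s] keeps it out of
   [take j s]. *)
have := H 'X_(nth i0 s j); rewrite !mem_var_ideal mem_rcons mem_head.
move=> /(_ isT) /(nthP i0)[l]; rewrite size_take js => lj.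
rewrite nth_take // => /eqP; rewrite nth_uniq ?(ltn_trans lj) // => /eqP lj'.
by rewrite lj' ltnn in lj.
Qed.

(* A chain of length h below a prime that contains I and one of length m - h
   above an ideal generated by h variables fill up the maximal length m. *)
Section Codimension.
Variables (I : {pred S}) (h : nat).
Hypothesis I_above : exists s : seq 'I_m,
  [/\ uniq s, size s = h & {subset I <= var_ideal s}].
Hypothesis I_below : forall p, prime_ideal p -> {subset I <= p} ->
  exists s : seq 'I_m, [/\ uniq s, size s = h & forall i, i \in s -> 'X_i \in p].

(** Take the ideals of the initial segments of [s] and put [p] in place of the last, [var_ideal s],
    which lies in [p]. *)
Lemma chain_below p : prime_ideal p -> {subset I <= p} ->
  exists2 c, prime_chain c h & c h =i p.
Proof.
move=> pP /(I_below pP)[s [us sh sp]].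
have pc : prime_chain (fun=> p) 0 by split.
have := prime_chain_cat (var_chain us) pc; rewrite sh addn0 => H.
eexists; first apply: H; last by move=> f /=; rewrite ltnn.
by rewrite -sh take_size; apply: var_ideal_sub => //; case: pP.
Qed.

Lemma chain_above : exists c,
  [/\ prime_chain c (m - h), {subset I <= c 0%N} & (h <= m)%N].
Proof.
have [s [us sh Is]] := I_above.
(* With all variables listed, [s] first, the chain of initial segments has length [m]; its part from
   index [h] on starts at [var_ideal s]. *)
pose t := s ++ enum [predC s].
have ut : uniq t.
  rewrite cat_uniq us enum_uniq andbT; apply/hasPn => i.
  by rewrite mem_enum inE.
have tm : size t = m.
  by rewrite size_cat -cardE -{1}(card_uniqP us) cardC card_ord.
have hm : (h <= m)%N by rewrite -tm size_cat sh leq_addr.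
have cP := var_chain ut; rewrite tm in cP.
eexists; split; [exact: prime_chain_drop cP hm| |exact: hm].
by rewrite /= addn0 -sh take_size_cat.
Qed.

Lemma codim_chain c e : prime_chain c e -> {subset I <= c 0%N} -> (h + e <= m)%N.
Proof.
move=> cP Ic; have [c' c'P c'h] := chain_below (cP.1 0%N isT) Ic.
by apply: prime_chain_mpoly (prime_chain_cat c'P cP _) => f; rewrite c'h.
Qed.

Lemma height_codim : height I h.
Proof.
have [c [cP Ic hm]] := chain_above; have c0P := cP.1 0%N isT.
split=> [|p e pP Ip [_ pe]]; last first.
  by have [c' c'P c'h] := chain_below pP Ip; apply: pe c'P c'h.
exists (c 0%N); split=> //; split; first exact: chain_below.
move=> c' e c'P c'e.
(* A chain of length [e] up to [c 0], continued by the [m - h] steps above, has at most [m]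
   steps. *)
have := prime_chain_mpoly (prime_chain_cat c'P cP _).
rewrite addnBA // leq_subLR leq_add2r; apply => f.
by rewrite c'e.
Qed.

End Codimension.

Lemma krull_dim_codim (I : idealr S) h :
  (exists s : seq 'I_m, [/\ uniq s, size s = h & {subset I <= var_ideal s}]) ->
  (forall p, prime_ideal p -> {subset I <= p} ->
    exists s : seq 'I_m, [/\ uniq s, size s = h & forall i, i \in s -> 'X_i \in p]) ->
  krull_dim {ideal_quot I} (m - h).
Proof.
move=> above below; have [c [cP Ic hm]] := chain_above above.
apply: krull_dim_quot => [|c' e c'P Ic']; first by exists c.
by rewrite leq_subRL //; apply: codim_chain below _ _ c'P Ic'.
Qed.

End VariableIdeals.

(** * The two ideals of the diamond poset *)

Lemma edge_label_inj n : injective (@edge_label n).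
Proof. by move=> x y /cast_ord_inj /enum_rank_inj. Qed.

Section DiamondIdeals.
Variables (k : fieldType) (n : nat).

Lemma I_path_above : exists s : seq 'I_(3 * n.+1).+1,
  [/\ uniq s, size s = 1%N & {subset I_path k n.+1 <= var_ideal s}].
Proof.
have [t tM] := diamond_max n.+1; have [r [rS rle rmax]] := diamond_rank n.+1.
exists [:: vertex_label t]; split=> //.
have vI := (@var_ideal_prime k _ [:: vertex_label t]).1.
apply: ideal_gen_sub => // _ [s /andP[sP /eqP sz] ->].
have rt x : r x = (2 * n.+1)%N -> x = t.
  by move=> /eqP; rewrite rmax (is_maxE _ tM) => /eqP.
have [s' ->] := saturated_chain_last rS rle rt sP sz.
by rewrite -cats1 big_cat big_seq1 /=; apply: idealM; rewrite // mem_var_ideal mem_head.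
Qed.

Lemma I_path_below p : prime_ideal p -> {subset I_path k n.+1 <= p} ->
  exists s : seq 'I_(3 * n.+1).+1,
    [/\ uniq s, size s = 1%N & forall i, i \in s -> 'X_i \in p].
Proof.
move=> pP Ip; have [s [_ [sP _ _]]] := diamond_two_chains n.
have /Ip /(prime_prod pP)[v _ vp] :
    (\prod_(v <- s) 'X_(vertex_label v))%R \in I_path k n.+1.
  by apply: mem_ideal_gen; exists s.
by exists [:: vertex_label v]; split=> // i /[1!inE] /eqP->.
Qed.

Lemma I_LD_above : exists s : seq 'I_(4 * n.+1),
  [/\ uniq s, size s = 2 & {subset I_LD k n.+1 <= var_ideal s}].
Proof.
have [t [a [b [tM ab at_ bt top]]]] := diamond_top n.
pose ea : edge (diamond n.+1) := Sub (a, t) at_.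
pose eb : edge (diamond n.+1) := Sub (b, t) bt.
exists [:: edge_label ea; edge_label eb]; split=> //.
  by rewrite /= inE (inj_eq (@edge_label_inj _)) -val_eqE /= xpair_eqE (negPf ab).
set l := [:: _; _]; have lI := (@var_ideal_prime k _ l).1.
apply: ideal_gen_sub => // _ [s smax ->].
have [s' [x [sE xt]]] := maximal_chain_last tM at_ smax.
(* The last edge of the chain reaches [t] from [a] or [b], so it is [ea] or [eb]. *)
have [e es el] : exists2 e : edge (diamond n.+1),
    val e \in zip s (behead s) & edge_label e \in l.
  have := top x xt; rewrite !inE => /orP[] /eqP xE; [exists ea | exists eb].
  - by rewrite SubK -xE sE zip_behead_rcons2.
  - by rewrite inE eqxx.
  - by rewrite SubK -xE sE zip_behead_rcons2.
  - by rewrite !inE eqxx orbT.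
by rewrite (bigD1 e) //= mulrC; apply: idealM; rewrite // mem_var_ideal.
Qed.

(* A prime above I_LD contains an edge of one of two edge-disjoint maximal
   chains, hence another edge, of the chain that avoids the first. *)
Lemma I_LD_below p : prime_ideal p -> {subset I_LD k n.+1 <= p} ->
  exists s : seq 'I_(4 * n.+1),
    [/\ uniq s, size s = 2 & forall i, i \in s -> 'X_i \in p].
Proof.
move=> pP Ip; have [s [s' [/andP[sP /eqP sz] /andP[sP' /eqP sz'] disj]]] :=
  diamond_two_chains n.
have [r [rS rle _]] := diamond_rank n.+1.
have var_in (q : seq (diamond n.+1)) : saturated_chain q -> size q = (2 * n.+1).+1 ->
    exists2 e : edge (diamond n.+1), val e \in zip q (behead q) & 'X_(edge_label e) \in p.
  move=> qP qz; apply: (prime_prod pP); apply: Ip; apply: mem_ideal_gen.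
  by exists q => //; apply: maximal_of_size rS rle qP qz.
have [e es ep] := var_in _ sP sz; have [e' es' ep'] := var_in _ sP' sz'.
exists [:: edge_label e; edge_label e']; split=> // [|i].
  (* A common edge would have both ends on both chains. *)
  rewrite /= inE andbT (inj_eq (@edge_label_inj _)); apply/eqP => ee'.
  rewrite -{}ee' {e' ep'} in es'.
  case: e es es' {ep} => -[x y] xy /= /mem_zip_behead/andP[xs ys].
  case/mem_zip_behead/andP=> xs' ys'.
  by have := disj x y xy xs xs' ys; rewrite ys'.
by rewrite !inE => /orP[] /eqP->.
Qed.

End DiamondIdeals.

Local Close Scope ring_scope.

Theorem lemma5p9 (k : fieldType) (n : nat) (n_gt0 : (0 < n)%N) :
  (height (I_LD k n) 2 /\ height (I_path k n) 1) /\
  (krull_dim {ideal_quot (I_LD_idealr k n_gt0)} (4 * n - 2) /\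
   krull_dim {ideal_quot (I_path_idealr k n)} (3 * n)).
Proof.
case: n n_gt0 => // n n_gt0; split; split.
- exact: height_codim (I_LD_above k n) (@I_LD_below k n).
- exact: height_codim (I_path_above k n) (@I_path_below k n).
- exact: (krull_dim_codim (I := I_LD_idealr k n_gt0) (I_LD_above k n) (@I_LD_below k n)).
rewrite -[(3 * n.+1)%N]/((3 * n.+1).+1 - 1)%N.
exact: (krull_dim_codim (I := I_path_idealr k n.+1) (I_path_above k n) (@I_path_below k n)).
Qed.
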